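(* There exists an embedding $f\colon (P(\omega)/\triangle_d)^{\omega}\to P(\omega)/\triangle_d$.
   Context: $\omega$ is the set of non-negative integers. A set $A\subseteq\omega$ has asymptotic density zero if $\lim_{n\to\infty}\frac{|A\cap n|}{n}=0$ (where $n=\{0,\dots,n-1\}$); $\triangle_d$ is the ideal of subsets of $\omega$ of asymptotic density zero and $P(\omega)/\triangle_d$ is the quotient Boolean algebra. $(P(\omega)/\triangle_d)^{\omega}$ is the product of countably many copies of this Boolean algebra with coordinatewise operations. An embedding is an injective homomorphism of Boolean algebras. *)

(* Defs.v *)
(* Mathematical Components with MathComp-Analysis *)
From HB Require Import structures.
From mathcomp Require Import all_boot all_order all_algebra finmap.
From mathcomp Require Import generic_quotient.
From mathcomp Require Import boolp classical_sets functions cardinality reals.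
From mathcomp Require Import topology normedtype sequences.

Set Implicit Arguments.
Unset Strict Implicit.
Unset Printing Implicit Defensive.

Import Order.Theory GRing.Theory Num.Theory.
Import numFieldNormedType.Exports.

Local Open Scope classical_set_scope.
Local Open Scope ring_scope.

(* Boolean algebras are the structures [ctbDistrLatticeType d]. The lattice
   morphisms of the order library do not cover complements, and its
   [{tblmorphism _ -> _}] only preserves the two bounds. *)
Definition boolean_morphism d (B : ctbDistrLatticeType d)
    d' (B' : ctbDistrLatticeType d') (f : B -> B') : Prop :=
  [/\ f \bot%O = \bot%O, f \top%O = \top%O,
      {morph f : x y / (x `&` y)%O}, {morph f : x y / (x `|` y)%O} &
      {morph f : x / (~` x)%O}].

Definition boolean_embedding d (B : ctbDistrLatticeType d)
    d' (B' : ctbDistrLatticeType d') (f : B -> B') : Prop :=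
  boolean_morphism f /\ injective f.

(* The library makes [I -> B] a lattice for the pointwise operations; the
   remaining Boolean structure is added here, again pointwise, so that
   [nat -> B] is the power of B with countably many factors. *)
Section FunBoolean.
Context (I : Type) d (B : ctbDistrLatticeType d).
Implicit Types f g h : I -> B.

Fact fun_meetUl : @left_distributive (I -> B) (I -> B) Order.meet Order.join.
Proof. by move=> f g h; apply/funext => i; exact: meetUl. Qed.

HB.instance Definition _ :=
  Order.Lattice_Meet_isDistrLattice.Build _ (I -> B) fun_meetUl.

Fact fun_le0x f : ((fun=> \bot : B) <= f)%O.
Proof. by apply/lefP => i; exact: le0x. Qed.

HB.instance Definition _ := Order.hasBottom.Build _ (I -> B) fun_le0x.

Fact fun_lex1 f : (f <= (fun=> \top : B))%O.
Proof. by apply/lefP => i; exact: lex1. Qed.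

HB.instance Definition _ := Order.hasTop.Build _ (I -> B) fun_lex1.

Definition fun_compl f : I -> B := fun i => (~` f i)%O.

Fact fun_joinxC f : (f `|` fun_compl f)%O = \top%O.
Proof. by apply/funext => i; exact: joinxC. Qed.

Fact fun_meetxC f : (f `&` fun_compl f)%O = \bot%O.
Proof. by apply/funext => i; exact: meetxC. Qed.

HB.instance Definition _ :=
  Order.TBDistrLattice_hasComplement.Build _ (I -> B) fun_joinxC fun_meetxC.

End FunBoolean.

Section DensityIdeal.
Variable R : realType.
Implicit Types A B C D : set nat.

Definition density_zero A : Prop :=
  (fun n => #|` fset_set (A `&` `I_n)|%:R / n%:R : R) @ \oo --> (0 : R).

Lemma density_zero0 : density_zero set0.
Proof.
rewrite /density_zero [X in X @ _ --> _](_ : _ = fun=> 0); first exact: cvg_cst.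
by apply/funext => n; rewrite set0I fset_set0 cardfs0 mul0r.
Qed.

Lemma density_zeroS A B : A `<=` B -> density_zero B -> density_zero A.
Proof.
move=> AB; apply: (@squeeze_cvgr _ _ _ _ (fun=> 0)); last exact: cvg_cst.
near=> n; rewrite divr_ge0//= ler_wpM2r ?invr_ge0// ler_nat.
have fI C : finite_set (C `&` `I_n).
  by apply: (sub_finite_set (@subIsetr _ _ _)); exact: finite_II.
apply: fsubset_leq_card; apply/fsubsetP => i.
by rewrite !in_fset_set// !inE/= => -[/AB Bi ?].
Unshelve. all: by end_near. Qed.

Lemma density_zeroU A B :
  density_zero A -> density_zero B -> density_zero (A `|` B).
Proof.
move=> A0 B0.
have := cvgD A0 B0; rewrite addr0 => /(_ _) AB0.
apply: (squeeze_cvgr _ (cvg_cst (0 : R)) AB0).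
near=> n; rewrite divr_ge0//= fctE -mulrDl -natrD ler_wpM2r ?invr_ge0// ler_nat.
have fI C : finite_set (C `&` `I_n).
  by apply: (sub_finite_set (@subIsetr _ _ _)); exact: finite_II.
by rewrite setIUl fset_setU// cardfsU leq_subr.
Unshelve. all: by end_near. Qed.

(* congruence modulo the ideal of sets of density zero *)
Definition density_eq A B : bool := `[< density_zero (A `+` B) >].

Fact density_eq_refl : reflexive density_eq.
Proof. by move=> A; apply/asboolP; rewrite setYK; exact: density_zero0. Qed.

Fact density_eq_sym : symmetric density_eq.
Proof. by move=> A B; rewrite /density_eq setYC. Qed.

Fact density_eq_trans : transitive density_eq.
Proof.
move=> B A C /asboolP AB /asboolP BC; apply/asboolP.
apply: density_zeroS (density_zeroU AB BC) => n; rewrite /setY/=.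
by have [] := pselect (B n); tauto.
Qed.

Canonical density_eq_equiv :=
  EquivRel density_eq density_eq_refl density_eq_sym density_eq_trans.

End DensityIdeal.

(* P(omega) / triangle_d *)
Definition density_algebra (R : realType) := {eq_quot (density_eq R)}%qT.

Fact density_display : Order.disp_t. Proof. exact: (Order.Disp tt tt). Qed.

Section DensityAlgebra.
Variable R : realType.
Local Notation Q := (density_algebra R).
Local Open Scope quotient_scope.
Implicit Types (A B C D : set nat) (x y z : Q).

HB.instance Definition _ := Choice.on Q.
HB.instance Definition _ := EqQuotient.on Q.

Definition dbot : Q := lift_cst Q set0.
Canonical pi_dbot := PiConst dbot.
Definition dtop : Q := lift_cst Q setT.
Canonical pi_dtop := PiConst dtop.
Definition dcompl : Q -> Q := lift_op1 Q (@setC nat).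
Definition dmeet : Q -> Q -> Q := lift_op2 Q (@setI nat).
Definition djoin : Q -> Q -> Q := lift_op2 Q (@setU nat).

Fact pi_dcompl : {morph \pi_Q : A / ~` A >-> dcompl A}.
Proof.
move=> A; unlock dcompl; apply/eqmodP/asboolP.
have /eqmodP/asboolP hA : A = repr (\pi_Q A) %[mod Q] by rewrite reprK.
apply: density_zeroS hA => n; rewrite /setY/=.
by have [] := pselect (A n); have [] := pselect (repr (\pi_Q A) n); tauto.
Qed.
Canonical pi_dcompl_morph := PiMorph1 pi_dcompl.

Fact pi_dmeet : {morph \pi_Q : A B / A `&` B >-> dmeet A B}.
Proof.
move=> A B; unlock dmeet; apply/eqmodP/asboolP.
have /eqmodP/asboolP hA : A = repr (\pi_Q A) %[mod Q] by rewrite reprK.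
have /eqmodP/asboolP hB : B = repr (\pi_Q B) %[mod Q] by rewrite reprK.
apply: density_zeroS (density_zeroU hA hB) => n; rewrite /setY/=.
have [] := pselect (repr (\pi_Q A) n); have [] := pselect (repr (\pi_Q B) n).
all: by have [] := pselect (A n); have [] := pselect (B n); tauto.
Qed.
Canonical pi_dmeet_morph := PiMorph2 pi_dmeet.

Fact pi_djoin : {morph \pi_Q : A B / A `|` B >-> djoin A B}.
Proof.
move=> A B; unlock djoin; apply/eqmodP/asboolP.
have /eqmodP/asboolP hA : A = repr (\pi_Q A) %[mod Q] by rewrite reprK.
have /eqmodP/asboolP hB : B = repr (\pi_Q B) %[mod Q] by rewrite reprK.
apply: density_zeroS (density_zeroU hA hB) => n; rewrite /setY/=.
have [] := pselect (repr (\pi_Q A) n); have [] := pselect (repr (\pi_Q B) n).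
all: by have [] := pselect (A n); have [] := pselect (B n); tauto.
Qed.
Canonical pi_djoin_morph := PiMorph2 pi_djoin.

Fact dmeetC : commutative dmeet.
Proof. by elim/quotW=> A; elim/quotW=> B; rewrite !piE setIC. Qed.

Fact djoinC : commutative djoin.
Proof. by elim/quotW=> A; elim/quotW=> B; rewrite !piE setUC. Qed.

Fact dmeetA : associative dmeet.
Proof.
by elim/quotW=> A; elim/quotW=> B; elim/quotW=> C; rewrite !piE setIA.
Qed.

Fact djoinA : associative djoin.
Proof.
by elim/quotW=> A; elim/quotW=> B; elim/quotW=> C; rewrite !piE setUA.
Qed.

Fact djoinKI y x : dmeet x (djoin x y) = x.
Proof.
by elim/quotW: x => A; elim/quotW: y => B; rewrite !piE setUC setKU.
Qed.

Fact dmeetKU y x : djoin x (dmeet x y) = x.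
Proof.
by elim/quotW: x => A; elim/quotW: y => B; rewrite !piE setIC setKI.
Qed.

Fact dmeetUl : left_distributive dmeet djoin.
Proof.
by elim/quotW=> A; elim/quotW=> B; elim/quotW=> C; rewrite !piE setIUl.
Qed.

Fact dmeetxx : idempotent_op dmeet.
Proof. by elim/quotW=> A; rewrite !piE setIid. Qed.

HB.instance Definition _ := Order.isMeetJoinDistrLattice.Build density_display Q
  (fun _ _ => erefl) (fun _ _ => erefl) dmeetC djoinC dmeetA djoinA
  djoinKI dmeetKU dmeetUl dmeetxx.

Fact dle0x x : (dbot <= x)%O.
Proof. by rewrite leEmeet; elim/quotW: x => A; rewrite /Order.meet/= !piE set0I. Qed.

HB.instance Definition _ := Order.hasBottom.Build density_display Q dle0x.

Fact dlex1 x : (x <= dtop)%O.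
Proof. by rewrite leEmeet; elim/quotW: x => A; rewrite /Order.meet/= !piE setIT. Qed.

HB.instance Definition _ := Order.hasTop.Build density_display Q dlex1.

Fact djoinxC x : (x `|` dcompl x)%O = \top%O.
Proof.
by elim/quotW: x => A; rewrite /Order.join /Order.top/= !piE setUCr.
Qed.

Fact dmeetxC x : (x `&` dcompl x)%O = \bot%O.
Proof.
by elim/quotW: x => A; rewrite /Order.meet /Order.bottom/= !piE setICr.
Qed.

HB.instance Definition _ :=
  Order.TBDistrLattice_hasComplement.Build density_display Q djoinxC dmeetxC.

Lemma eq_density_algebraP A B :
  \pi_Q A = \pi_Q B <-> density_zero R (A `+` B).
Proof. by split => [/eqmodP/asboolP|AB]; last exact/eqmodP/asboolP. Qed.

Lemma density_algebra_bot : \pi_Q set0 = \bot%O.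
Proof. by rewrite /Order.bottom/= !piE. Qed.

Lemma density_algebra_top : \pi_Q setT = \top%O.
Proof. by rewrite /Order.top/= !piE. Qed.

Lemma density_algebra_meet A B : \pi_Q (A `&` B) = (\pi_Q A `&` \pi_Q B)%O.
Proof. exact: pi_dmeet. Qed.

Lemma density_algebra_join A B : \pi_Q (A `|` B) = (\pi_Q A `|` \pi_Q B)%O.
Proof. exact: pi_djoin. Qed.

Lemma density_algebra_compl A : \pi_Q (~` A) = (~` \pi_Q A)%O.
Proof. exact: pi_dcompl. Qed.

End DensityAlgebra.

(* Main.v *)
Require Import Defs.
From mathcomp Require Import all_boot all_order all_algebra reals.
From mathcomp Require Import finmap boolp classical_sets cardinality.
From mathcomp Require Import normedtype interval_inference zify.

(** Every n is uniquely of the form n + 1 = 2 ^ k * (2 m + 1).  For fixed k, the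
    numbers of this form make up a copy of the natural numbers, of density
    2 ^ - (k + 1), and a sequence of sets A is sent to the set [merge A] that
    contains m in its k-th copy exactly when m is in A k.  Since [merge] is a
    preimage, it commutes with all the Boolean operations on the nose; what has
    to be shown is that it goes to the quotient and stays injective there, that
    is, that [merge A] has density zero if and only if every A k has.

    From left to right ([density_zero_of_merge]), the k-th copy stretches
    distances by a factor of at most 2 ^ (k + 1), so that passing to A k
    multiplies densities by at most that constant.  From right to left
    ([density_zero_merge]), the parts of [merge A] in the first K copies are null
    for each K, since copying only moves points up; all the other copies together
    consist of the n with n + 1 divisible by 2 ^ K, which occupy at most a
    fraction 2 ^ - K of every initial segment.  The geometric decay of the copies
    is what makes infinitely many null sets add up to a null set.

    Applied to symmetric differences, one direction gives well-definedness on
    classes and the other injectivity. *)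

Import Order.Theory GRing.Theory Num.Theory.
Import numFieldNormedType.Exports.

Local Open Scope classical_set_scope.
Local Open Scope ring_scope.

Definition count_below (A : set nat) (n : nat) : nat :=
  #|` fset_set (A `&` `I_n)|.

Lemma finite_below (A : set nat) n : finite_set (A `&` `I_n).
Proof. exact/(sub_finite_set (@subIsetr _ _ _))/finite_II. Qed.

(** A map and a left inverse of it can both play the role of g: all that counts
    is that the points of B are reached, so images and preimages of a set are
    estimated by the same comparison. *)
Lemma count_below_surj (g : nat -> nat) (A B : set nat) (m n : nat) :
  (forall i, B i -> (i < n)%N -> exists2 j, A j /\ (j < m)%N & g j = i) ->
  (count_below B n <= count_below A m)%N.
Proof.
move=> gAB; rewrite /count_below.
have le_im : (#|` (g @` fset_set (A `&` `I_m))%fset| <= count_below A m)%N.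
  exact: leq_imfset_card.
apply: leq_trans le_im; apply: fsubset_leq_card; apply/fsubsetP => i.
rewrite in_fset_set ?inE /=; last exact: finite_below.
move=> [Bi ltin]; have [j [Aj ltjm] <-] := gAB i Bi ltin.
apply: in_imfset; rewrite /= in_fset_set ?inE //; exact: finite_below.
Qed.

Lemma count_below_le (A : set nat) n : (count_below A n <= n)%N.
Proof.
rewrite -[leqRHS](card_fset_set (card_eqxx `I_n)) /count_below.
apply: fsubset_leq_card; apply/fsubsetP => i.
rewrite !in_fset_set ?inE /=; [by case|exact: finite_II|exact: finite_below].
Qed.

(** Clearing denominators turns the limit into inequalities between natural
    numbers, with 1 / K in the role of epsilon. *)
Lemma density_zeroP (R : realType) (A : set nat) :
  density_zero R A <->
  forall K : nat, exists N, forall n,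
    (N <= n)%N -> (K * count_below A n <= n)%N.
Proof.
split=> [A0 [|K]|A0]; first by exists 0%N => n _; rewrite mul0n.
  have e0 : 0 < (K.+1%:R : R)^-1 by rewrite invr_gt0.
  have /cvgr0_norm_le/(_ _ e0)[N _ AN] := A0.
  exists N.+1 => n ltNn; have := AN n (ltnW ltNn).
  rewrite /= ger0_norm ?divr_ge0 // ler_pdivrMr ?ltr0n; last by lia.
  by rewrite mulrC ler_pdivlMr // -natrM ler_nat mulnC.
apply/cvgr0Pnorm_le => e e0.
have [K _ /(_ K (leqnn K)) Ke] := near_infty_natSinv_lt (PosNum e0).
have [N AN] := A0 K.+1; exists N.+1 => // n /= ltNn.
rewrite ger0_norm ?divr_ge0 //; apply: le_trans (ltW Ke).
rewrite ler_pdivrMr ?ltr0n; last by lia.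
by rewrite mulrC ler_pdivlMr // -natrM ler_nat mulnC AN // ltnW.
Qed.

(** Null sets are closed under approximation in upper density, here with the
    error bound K^-1 uniform in n: halving epsilon, B and the error A \ B
    each contribute at most n / (2 K) elements below n. *)
Lemma density_zero_approx (R : realType) (A : set nat) :
  (forall K : nat, exists2 B, density_zero R B &
     forall n, (K * count_below (A `\` B) n <= n)%N) ->
  density_zero R A.
Proof.
move=> AB; apply/density_zeroP => K.
have [B /density_zeroP/(_ (2 * K)%N)[N BN] AB_le] := AB (2 * K)%N.
exists N => n leNn.
suff : (count_below A n <= count_below (A `\` B) n + count_below B n)%N.
  by have := BN n leNn; have := AB_le n; nia.
have fI := finite_below.
rewrite /count_below; apply: leq_trans (leq_card_fsetU _ _).
rewrite -fset_setU //; apply: fsubset_leq_card; apply/fsubsetP => i.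
rewrite !in_fset_set ?inE /=; last 2 first.
- by rewrite finite_setU.
- exact: fI.
by move=> [Ai ltin]; have [Bi|nBi] := pselect (B i); [right|left].
Qed.

Lemma density_zero_image (R : realType) (g : nat -> nat) (A : set nat) :
  (forall m, (m <= g m)%N) -> density_zero R A -> density_zero R (g @` A).
Proof.
move=> g_ge /density_zeroP A0; apply/density_zeroP => K.
have [N AN] := A0 K; exists N => n leNn.
apply: leq_trans (AN n leNn); rewrite leq_mul2l; apply/orP; right.
apply: (count_below_surj g) => _ [j Aj <-] ltn; exists j => //.
by split=> //; apply: leq_ltn_trans ltn.
Qed.

(** The bijection (k, m) |-> n with n + 1 = 2 ^ k * (2 m + 1); [copy_of] and
    [index_in_copy] are the two components of its inverse. *)
Definition encode (k m : nat) : nat := (2 ^ k * m.*2.+1).-1.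
Definition copy_of (n : nat) : nat := logn 2 n.+1.
Definition index_in_copy (n : nat) : nat := (n.+1 %/ 2 ^ copy_of n)./2.

Lemma encodeS k m : (encode k m).+1 = (2 ^ k * m.*2.+1)%N.
Proof. by rewrite prednK // muln_gt0 expn_gt0. Qed.

Lemma encode_copy_index n : encode (copy_of n) (index_in_copy n) = n.
Proof.
rewrite /encode /index_in_copy /copy_of.
have dvd := pfactor_dvdnn 2 n.+1.
have quotient_odd :
    (n.+1 %/ 2 ^ logn 2 n.+1 = (n.+1 %/ 2 ^ logn 2 n.+1)./2.*2.+1)%N.
  rewrite -[LHS]odd_double_half.
  (* The quotient is the odd part of n + 1. *)
  have [m cop def_n] := pfactor_coprime (isT : prime 2) (ltn0Sn n).
  have -> : (n.+1 %/ 2 ^ logn 2 n.+1 = m)%N.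
    by rewrite [X in (X %/ _)%N]def_n mulnK ?expn_gt0.
  by rewrite coprime2n in cop; rewrite cop.
by rewrite -quotient_odd mulnC divnK.
Qed.

Lemma copy_of_encode k m : copy_of (encode k m) = k.
Proof.
rewrite /copy_of encodeS lognM ?expn_gt0 // pfactorK // lognE.
by rewrite dvdn2 /= odd_double addn0.
Qed.

Lemma index_in_copy_encode k m : index_in_copy (encode k m) = m.
Proof.
rewrite /index_in_copy copy_of_encode encodeS mulKn ?expn_gt0 //.
by rewrite -[_.+1]/(true + m.*2)%N half_bit_double.
Qed.

Definition merge (A : nat -> set nat) : set nat :=
  [set n | A (copy_of n) (index_in_copy n)].

Lemma density_zero_merge (R : realType) (A : nat -> set nat) :
  (forall k, density_zero R (A k)) -> density_zero R (merge A).
Proof.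
move=> A0; apply: density_zero_approx => K.
(* Approximate by the part in the first K copies, a finite union of null images. *)
exists (\bigcup_(k in `I_K) (encode k @` A k)).
  elim: K => [|K IHK]; first by rewrite II0 bigcup_set0; exact: density_zero0.
  rewrite IIS bigcup_setU bigcup_set1; apply: density_zeroU IHK _.
  apply: density_zero_image => // m.
  by have := encodeS K m; have := expn_gt0 2 K; nia.
move=> n; apply: (@leq_trans (2 ^ K * (n %/ 2 ^ K))%N); last first.
  by rewrite mulnC leq_divM.
apply: leq_mul; first exact/ltnW/ltn_expl.
apply: leq_trans (count_below_le setT _).
(* What is left lies among the multiples of 2 ^ K, shifted by one; those below n
   are indexed by the j < n / 2 ^ K. *)
apply: (count_below_surj (fun j => (2 ^ K * j.+1).-1)) => i [Ai nAi] ltin.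
have leK : (K <= copy_of i)%N.
  rewrite leqNgt; apply/negP => ltK; apply: nAi.
  exists (copy_of i) => //.
  by exists (index_in_copy i) => //; exact: encode_copy_index.
have /dvdnP[q def_i] : (2 ^ K %| i.+1)%N by rewrite pfactor_dvdn.
have q0 : (0 < q)%N by case: q def_i.
exists q.-1; last by rewrite prednK // mulnC -def_i.
by split=> //; rewrite prednK // leq_divRL ?expn_gt0 // -def_i.
Qed.

(** Below n, each element of A k has its code below 2 ^ (k + 1) * n, so the count
    of A k below n is at most that of [merge A] below 2 ^ (k + 1) * n. *)
Lemma density_zero_of_merge (R : realType) (A : nat -> set nat) k :
  density_zero R (merge A) -> density_zero R (A k).
Proof.
move=> /density_zeroP A0; apply/density_zeroP => K.
have [N AN] := A0 (K * 2 ^ k.+1)%N; exists N => n leNn.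
have p0 : (0 < 2 ^ k)%N by rewrite expn_gt0.
have /AN : (N <= 2 ^ k.+1 * n)%N by rewrite expnS; nia.
rewrite mulnAC (mulnC (K * _)%N) leq_pmul2l ?expn_gt0 //; apply: leq_trans.
rewrite leq_mul2l; apply/orP; right.
apply: (count_below_surj index_in_copy) => i Ai ltin.
exists (encode k i); last exact: index_in_copy_encode.
split; first by rewrite /merge /= copy_of_encode index_in_copy_encode.
by rewrite encodeS expnS; nia.
Qed.

Definition merge_class (R : realType) (x : nat -> density_algebra R) :
    density_algebra R :=
  \pi_(density_algebra R)%qT (merge (fun k => repr (x k))).

(** Representatives are chosen coordinatewise, and any other choice changes the
    merged set by a merge of null sets.  Hence [merge_class] commutes with the
    Boolean operations because [merge] does. *)
Lemma pi_merge (R : realType) (A : nat -> set nat)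
    (x : nat -> density_algebra R) :
  (forall k, \pi_(density_algebra R)%qT (A k) = x k) ->
  merge_class R x = \pi_(density_algebra R)%qT (merge A).
Proof.
move=> Ax; apply/eq_density_algebraP.
apply: (density_zero_merge R (fun k => repr (x k) `+` A k)) => k.
by apply/eq_density_algebraP; rewrite reprK Ax.
Qed.

Theorem proposition4 (R : realType) :
  exists f : (nat -> density_algebra R) -> density_algebra R,
    boolean_embedding f.
Proof.
exists (merge_class R); split; last first.
  move=> x y /eq_density_algebraP xy; apply/funext => k.
  rewrite -[x k]reprK -[y k]reprK; apply/eq_density_algebraP.
  exact: (density_zero_of_merge R (fun k => repr (x k) `+` repr (y k))).
split.
- rewrite -density_algebra_bot; apply: (pi_merge R (fun=> set0)) => k.
  exact: density_algebra_bot.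
- rewrite -density_algebra_top; apply: (pi_merge R (fun=> setT)) => k.
  exact: density_algebra_top.
- move=> x y; rewrite -density_algebra_meet.
  apply: (pi_merge R (fun k => repr (x k) `&` repr (y k))) => k.
  by rewrite density_algebra_meet !reprK.
- move=> x y; rewrite -density_algebra_join.
  apply: (pi_merge R (fun k => repr (x k) `|` repr (y k))) => k.
  by rewrite density_algebra_join !reprK.
- move=> x; rewrite -density_algebra_compl.
  apply: (pi_merge R (fun k => ~` repr (x k))) => k.
  by rewrite density_algebra_compl !reprK.
Qed.
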